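(* For every numerical constant $C>0$ there is a numerical constant $C_{\mathrm{st}}$ (depending only on $C$) such that the following holds. Let $T\ge1$, $\sigma>0$, and let $(\mathcal{H}_k)_{k=0}^T$ be a filtration. For $k=0,\dots,T-1$ let $q_k\in(0,1]$ and $v_k\ge0$ be $\mathcal{H}_k$-measurable and let $\vartheta_k$ be $\mathcal{H}_{k+1}$-measurable, with $$\mathbb{E}[\vartheta_k\mid\mathcal{H}_k]=0,\qquad \mathbb{E}[\exp(\lambda\vartheta_k)\mid\mathcal{H}_k]\le\exp(\lambda^2\sigma^2v_k),\qquad\lambda\in\mathbb{R}.$$ Set $P_0=1$, $P_K=\prod_{t=0}^{K-1}q_t$, and, with $\widetilde M_K=\sum_{k=0}^{K-1}\frac{\vartheta_k}{P_{k+1}}$, $$S_K=P_K\widetilde M_K,\qquad A_K=P_K^2\sum_{k=0}^{K-1}\frac{v_k}{P_{k+1}^2},\qquad K=1,\dots,T.$$ Assume that, for a deterministic number $B_T\ge1$, on an event $\mathcal{P}_T$ one has $P_K^{-2}\le B_T$ for $K=1,\dots,T$. Let $\bar A_K>0$, $K=1,\dots,T$, be deterministic, set $U_\star:=B_T\max_{K\le T}\bar A_K$, and assume that, for some $0<\delta<1$ and some number $G$, $$G\ge1+\log\frac1\delta,\qquad \max_{K\le T}\log\Big(1+\log\Big(e+\frac{U_\star}{\bar A_K}\Big)\Big)\le C\,G.$$ Then $$\Pr\Big(\mathcal{P}_T\cap\Big\{\exists K\le T:\ A_K\le\bar A_K,\ S_K>C_{\mathrm{st}}\,\sigma\sqrt{\bar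 A_KG}\Big\}\Big)\le\delta.$$
   Context: All random variables live on a common probability space; indices $K$ range over $1\le K\le T$. *)

(* Defs.v *)
From mathcomp Require Import all_boot all_order all_algebra.
From mathcomp Require Import all_classical all_reals all_analysis.
From mathcomp Require Import measurable_realfun.
Set Implicit Arguments.
Unset Strict Implicit.
Unset Printing Implicit Defensive.
Import Order.TTheory GRing.Theory Num.Theory numFieldNormedType.Exports.

Local Open Scope classical_set_scope.
Local Open Scope ring_scope.

(* The sigma-algebra generated by X is contained in G. *)
Definition measurable_wrt (Omega : Type) (d : measure_display)
    (E : measurableType d) (G : set (set Omega)) (X : Omega -> E) : Prop :=
  preimage_set_system setT X (@measurable d E) `<=` G.

(* Only the values H 0, ..., H T are constrained. *)
Definition filtration (d : measure_display) (Omega : measurableType d)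
    (T : nat) (H : nat -> set (set Omega)) : Prop :=
  [/\ forall k, (k <= T)%N -> sigma_algebra setT (H k),
      forall k, (k <= T)%N -> H k `<=` @measurable d Omega &
      forall j k, (j <= k)%N -> (k <= T)%N -> H j `<=` H k].

(* Y is a version of E[X | G]. As usual, X has to be either integrable or
   nonnegative; in the second case E[X | G] may take the value +oo. *)
Definition is_cond_exp (R : realType) (d : measure_display)
    (Omega : measurableType d) (P : probability Omega R)
    (G : set (set Omega)) (X Y : Omega -> \bar R) : Prop :=
  [/\ measurable_fun setT X,
      measurable_wrt G Y,
      (P.-integrable setT X /\ P.-integrable setT Y) \/
      ((forall w, (0 <= X w)%E) /\ {ae P, forall w, (0 <= Y w)%E}) &
      forall A, G A -> (\int[P]_(w in A) Y w = \int[P]_(w in A) X w)%E].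

Definition cond_exp_le (R : realType) (d : measure_display)
    (Omega : measurableType d) (P : probability Omega R)
    (G : set (set Omega)) (X Z : Omega -> \bar R) : Prop :=
  exists2 Y, is_cond_exp P G X Y & {ae P, forall w, (Y w <= Z w)%E}.

Section processes.
Variables (R : realType) (Omega : Type).
Variables q v theta : nat -> Omega -> R.

Definition Pprod (K : nat) (w : Omega) : R := \prod_(t < K) q t w.

Definition Mtilde (K : nat) (w : Omega) : R :=
  \sum_(k < K) theta k w / Pprod k.+1 w.

Definition Sproc (K : nat) (w : Omega) : R := Pprod K w * Mtilde K w.

Definition Aproc (K : nat) (w : Omega) : R :=
  Pprod K w ^+ 2 * \sum_(k < K) v k w / Pprod k.+1 w ^+ 2.

End processes.

(* max_{1 <= K <= T} f K, for T >= 1. The value f 1 belongs to the family, so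
   that starting from it gives the exact maximum whatever the sign of f. *)
Definition max_upto (R : realType) (T : nat) (f : nat -> R) : R :=
  \big[Num.max/f 1%N]_(1 <= K < T.+1) f K.

(* Main.v *)
Require Import Defs.
From mathcomp Require Import all_boot all_order all_algebra.
From mathcomp Require Import all_classical all_reals all_analysis.
From mathcomp Require Import measurable_realfun.
From mathcomp Require Import ring lra.
Set Implicit Arguments.
Unset Strict Implicit.
Unset Printing Implicit Defensive.
Import Order.TTheory GRing.Theory Num.Theory numFieldNormedType.Exports.

Local Open Scope classical_set_scope.
Local Open Scope ring_scope.

(** Dividing by the random contraction P_K turns the statement into one about
    the martingale M_K = sum of theta_k / P_(k+1), with variance proxy
    V_K = sum of v_k / P_(k+1)^2.  On the crossing event, put
    u = Abar_K / P_K^2: then V_K <= u and M_K > Cst sigma sqrt(u G).  The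
    variance budget u is random, but the bounds on P_K confine it to the
    interval from Abar_K to Ustar, whatever the size of the noise.

    For a fixed slope lambda, the process
    W_K = exp(lambda M_K - lambda^2 sigma^2 V_K) is a nonnegative
    supermartingale started at 1, so by the maximal inequality the line
    lambda M_K - lambda^2 sigma^2 V_K ever reaches the height x with probability
    at most exp(-x) ([subgaussian_line_crossing]).  The slope that is good for
    the budget u is of order sqrt(G / u) / sigma, which depends on u.  The
    interval of budgets is therefore peeled into the layers
    Ustar e^-(j+1) < u <= Ustar e^-j; on the layer j one uses one slope
    lambda_j, tuned to Ustar e^-j, and the height
    x_j = log ((j+1)(j+2)/delta).  The failure probabilities
    delta / ((j+1)(j+2)) telescope to at most delta.  The height x_j is at most
    log (1/delta) + 2 log (j+1) + log 2 with j <= log (Ustar / Abar_K), and the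
    iterated logarithm hypothesis bounds log (j+1) by C G
    ([boundary_crossing_line_crossing]).

    The subgaussian hypothesis holds for each deterministic lambda, up to a null
    set depending on lambda, whereas the increment of M_K carries the
    H_k-measurable factor 1 / P_(k+1).  [le_integral_random_parameter] makes the
    passage from deterministic to H_k-measurable parameters, at the level of
    integrals over the sets of H_k, so that no conditional expectation with a
    parameter has to be handled. *)

(** * Measurability with respect to a sub-sigma-algebra *)

(** Gives access to the closure properties of measurable functions, which are
    stated for a type carrying its own sigma-algebra. *)
Lemma measurable_wrtP (d' : measure_display) (Omega : pointedType)
    (E : measurableType d') (G : set (set Omega)) (X : Omega -> E) :
  sigma_algebra setT G ->
  measurable_wrt G X <->
  measurable_fun setT (X : g_sigma_algebraType G -> E).
Proof.
move=> sG; have GE : <<s G >> = G by exact: sigma_algebra_id.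
split=> [GX _ B mB|mX _ [B mB <-]].
  by rewrite /measurable/= GE; apply: GX; exists B.
by have := mX measurableT B mB; rewrite /measurable/= GE.
Qed.

Lemma sigma_algebra_setI (Omega : pointedType)
    (G : set (set Omega)) (A B : set Omega) :
  sigma_algebra setT G -> G A -> G B -> G (A `&` B).
Proof.
move=> sG; rewrite -(sigma_algebra_id sG).
exact: (@measurableI _ (g_sigma_algebraType G)).
Qed.

Lemma measurable_wrt_le (d' : measure_display) (Omega : Type)
    (E : measurableType d') (G G' : set (set Omega)) (X : Omega -> E) :
  G `<=` G' -> measurable_wrt G X -> measurable_wrt G' X.
Proof. by move=> GG' GX B /GX/GG'. Qed.

Lemma measurable_wrt_fun (d d' : measure_display) (Omega : measurableType d)
    (E : measurableType d') (G : set (set Omega)) (X : Omega -> E) :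
  G `<=` @measurable d Omega -> measurable_wrt G X -> measurable_fun setT X.
Proof. by move=> GM GX _ B mB; apply: GM; apply: GX; exists B. Qed.

Lemma measurable_wrt_lt (Omega : Type) (R : realType)
    (G : set (set Omega)) (X : Omega -> R) (c : R) :
  measurable_wrt G X -> G [set w | X w < c].
Proof.
move=> GX; apply: GX; exists `]-oo, c[%classic => //.
by rewrite setTI; apply/seteqP; split=> w /=; rewrite in_itv.
Qed.

(** * Random parameters in integral inequalities *)

Import HBNNSimple.

(** When L takes finitely many values, A is cut into the pieces on which L is
    constant, and these belong to G.  In general L is the increasing limit of
    simple functions L_n: on the left Fatou's lemma and the continuity of f in
    its parameter give the limit, and on the right g (L_n w) w <= g (L w) w, so
    that no domination is needed. *)
Lemma le_integral_random_parameter (d : measure_display) (Omega : measurableType d)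
    (R : realType) (mu : {measure set Omega -> \bar R})
    (G : set (set Omega)) (f g : R -> Omega -> R) (L : Omega -> R) :
  sigma_algebra setT G -> G `<=` @measurable d Omega ->
  (forall x, measurable_fun setT (f x)) ->
  (forall x, measurable_fun setT (g x)) ->
  (forall x w, 0 <= f x w) -> (forall x w, 0 <= g x w) ->
  (forall x A, G A ->
    (\int[mu]_(w in A) (f x w)%:E <= \int[mu]_(w in A) (g x w)%:E)%E) ->
  (forall w, continuous (f ^~ w)) ->
  (forall x y w, 0 <= x -> x <= y -> g x w <= g y w) ->
  measurable_wrt G L -> (forall w, 0 <= L w) ->
  measurable_fun setT (fun w => g (L w) w) ->
  forall A, G A ->
  (\int[mu]_(w in A) (f (L w) w)%:E <= \int[mu]_(w in A) (g (L w) w)%:E)%E.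
Proof.
move=> sG GM mf mg f0 g0 fg fc gnd mL L0 mgL A GA.
have mA : measurable A by exact: GM.
have mL' : measurable_fun setT
    (EFin \o L : g_sigma_algebraType G -> \bar R).
  by apply/measurable_EFinP; exact/measurable_wrtP.
have [h [hnd hcvg]] := approximation measurableT mL' (fun t _ => L0 t).
have hcv w : (h n w @[n --> \oo] --> L w)%R.
  by have /fine_cvgP[] := hcvg w I.
have hL n w : h n w <= L w.
  rewrite -(cvg_lim (@Rhausdorff R) (hcv w)).
  apply: (@nondecreasing_cvgn_le _ (h ^~ w)); last by apply/cvg_ex; exists (L w).
  by move=> a b ab; have /lefP := hnd _ _ ab; exact.
have Gpre n y : G (h n @^-1` [set y]).
  have := @measurable_sfunP _ _ _ _ (h n) _ (measurable_set1 y).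
  by rewrite /measurable/= (sigma_algebra_id sG).
have mpre n y : measurable (h n @^-1` [set y] : set Omega) by exact/GM/Gpre.
pose F (e : R -> Omega -> R) n y w :=
  (e y w * \1_(h n @^-1` [set y] : set Omega) w)%:E.
(* Both f and g split along the values y of the simple function h n. *)
have FE (e : R -> Omega -> R) n w :
    (e (h n w) w)%:E = \sum_(y \in range (h n)) F e n y w.
  rewrite (fsbigD1 (h n w))//=; last by exists w.
  rewrite /F indicE mem_set// mulr1 fsbig1 ?adde0//.
  by move=> y [_ /= /nesym yh]; rewrite indicE memNset ?mulr0.
have mF (e : R -> Omega -> R) n y : measurable_fun setT (e y) -> measurable_fun A (F e n y).
  move=> me; apply: (@measurable_funS _ _ _ _ setT) => //.
  by apply/measurable_EFinP; apply: measurable_funM => //; exact: measurable_indic.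
have mFh (e : R -> Omega -> R) n : (forall x, measurable_fun setT (e x)) ->
    measurable_fun A (fun w => (e (h n w) w)%:E).
  move=> me; under eq_fun do rewrite FE.
  by apply: emeasurable_fsum => // y; exact: mF.
have intFh (e : R -> Omega -> R) n : (forall x, measurable_fun setT (e x)) ->
    (forall x w, 0 <= e x w) ->
    (\int[mu]_(w in A) (e (h n w) w)%:E =
     \sum_(y \in range (h n))
       \int[mu]_(w in A `&` h n @^-1` [set y]) (e y w)%:E)%E.
  move=> me e0; under eq_integral do rewrite FE.
  rewrite ge0_integral_fsum//; first last.
  - by move=> y w _; rewrite lee_fin mulr_ge0.
  - by move=> y; exact: mF.
  apply: eq_fsbigr => y _; rewrite integral_mkcondr; apply: eq_integral => w _.
  rewrite /F /patch indicE; case: ifPn => _; last by rewrite mulr0.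
  by rewrite mulr1.
have le_n n : (\int[mu]_(w in A) (f (h n w) w)%:E <=
               \int[mu]_(w in A) (g (L w) w)%:E)%E.
  apply: (@le_trans _ _ (\int[mu]_(w in A) (g (h n w) w)%:E)%E).
    rewrite !intFh//; apply: lee_fsum => // y _; apply: fg.
    exact: sigma_algebra_setI.
  apply: ge0_le_integral => //.
  - by move=> w _; rewrite lee_fin.
  - exact: mFh.
  - by apply: (@measurable_funS _ _ _ _ setT) => //; apply/measurable_EFinP.
  - by move=> w _; rewrite lee_fin gnd.
have -> : (\int[mu]_(w in A) (f (L w) w)%:E =
           \int[mu]_(w in A) limn_einf (fun n => (f (h n w) w)%:E))%E.
  apply: eq_integral => w _.
  have cw : ((f (h n w) w)%:E @[n --> \oo] --> (f (L w) w)%:E)%E.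
    apply: cvg_EFin; first by near=> n.
    exact: (cvg_comp _ _ (hcv w) (fc w (L w))).
  by rewrite (cvg_limn_einf_sup cw).1.
apply: le_trans; first by apply: fatou => // n; [exact: mFh|move=> w _; rewrite lee_fin].
rewrite limn_einf_lim; apply: lime_le; first exact: is_cvg_einfs.
near=> n; apply: le_trans (le_n n).
by apply: ereal_inf_lbound; exists n => //=.
Unshelve. all: by end_near. Qed.

(** * The maximal inequality for nonnegative supermartingales *)

(** Markov's inequality that keeps the mass left below the level, which is what
    the next step of the induction on time consumes. *)
Lemma integral_split_level (d : measure_display) (Omega : measurableType d)
    (R : realType) (mu : {measure set Omega -> \bar R}) (X : Omega -> R)
    (c : R) (A : set Omega) :
  measurable_fun setT X -> (forall w, 0 <= X w) -> 0 <= c -> measurable A ->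
  (c%:E * mu (A `&` [set w | (c <= X w)%R]) +
    \int[mu]_(w in A `&` [set w | (X w < c)%R]) (X w)%:E <=
   \int[mu]_(w in A) (X w)%:E)%E.
Proof.
move=> mX X0 c0 mA.
have mL : measurable [set w | c <= X w].
  by have := measurable_fun_le measurableT (measurable_cst c) mX; rewrite setTI.
have mS : measurable [set w | X w < c].
  rewrite (_ : [set _ | _] = ~` [set w | c <= X w]); first exact: measurableC.
  by apply/seteqP; split=> w /=; rewrite ltNge => /negP.
have -> : (\int[mu]_(w in A) (X w)%:E =
   \int[mu]_(w in (A `&` [set w | (c <= X w)%R]) `|`
                  (A `&` [set w | (X w < c)%R])) (X w)%:E)%E.
  congr integral; rewrite -setIUr; apply/esym/setIidl => w _ /=.
  by case: (leP c (X w)); [left|right].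
have mXE D : measurable_fun D (EFin \o X).
  by apply: (@measurable_funS _ _ _ _ setT) => //; exact/measurable_EFinP.
have mAL := measurableI _ _ mA mL; have mAS := measurableI _ _ mA mS.
rewrite ge0_integral_setU//; last 2 first.
- by move=> w _; rewrite lee_fin.
- rewrite disj_set2E; apply/eqP; rewrite -subset0 => w [[_ /= cX] [_ /=]].
  by rewrite ltNge cX.
apply: leeD => //; rewrite -integral_cst//.
apply: ge0_le_integral => //.
- by move=> w [].
Qed.

(** N K is the event that W has not reached the level c by time K.  The quantity
    c P(~ N K) + (integral of W_K over N K) does not increase with K: passing from
    W_K to W_(K+1) on N K, which lies in H_K, loses nothing by the
    supermartingale property, and the part of N K that reaches c at time K+1 pays
    at least c times its probability. *)
Lemma supermartingale_maximal_inequality (d : measure_display)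
    (Omega : measurableType d) (R : realType) (P : probability Omega R)
    (T : nat) (H : nat -> set (set Omega)) (W : nat -> Omega -> R) (c : R) :
  filtration T H -> 0 <= c ->
  (forall k, (k <= T)%N -> measurable_wrt (H k) (W k)) ->
  (forall k w, 0 <= W k w) ->
  (\int[P]_w (W 0%N w)%:E <= 1)%E ->
  (forall k A, (k < T)%N -> H k A ->
    (\int[P]_(w in A) (W k.+1 w)%:E <= \int[P]_(w in A) (W k w)%:E)%E) ->
  (c%:E * P [set w | exists2 k, (k <= T)%N & (c <= W k w)%R] <= 1)%E.
Proof.
move=> [Hs HM Hnd] c0 Wad W0 W01 Wdec.
pose N K := [set w | forall i, (i <= K)%N -> W i w < c].
have N0 : N 0%N = setT `&` [set w | W 0%N w < c].
  rewrite setTI; apply/seteqP; split=> w /= Nw; first exact: Nw.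
  by move=> i; rewrite leqn0 => /eqP ->.
have NS K : N K.+1 = N K `&` [set w | W K.+1 w < c].
  apply/seteqP; split=> w /=.
    by move=> Nw; split; [move=> i iK; apply: Nw; exact: leqW|exact: Nw].
  by move=> [Nw WK] i; rewrite leq_eqVlt => /predU1P[->//|]; exact: Nw.
have NCS K : ~` N K.+1 = ~` N K `|` (N K `&` [set w | c <= W K.+1 w]).
  rewrite NS; apply/seteqP; split=> w /=.
    have [Nw|Nw] := pselect (N K w); last by left.
    by move=> nN; right; split => //=; rewrite leNgt; apply/negP => WK; apply: nN.
  by move=> [nN [//]|[Nw cW] [_]]; rewrite ltNge cW.
have HN K : (K <= T)%N -> H K (N K).
  elim: K => [KT|K IH KT].
    by rewrite N0 setTI; apply: measurable_wrt_lt; exact: Wad.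
  rewrite NS; apply: sigma_algebra_setI; first exact: Hs.
    by apply: (Hnd K K.+1) => //; apply: IH; exact: ltnW.
  by apply: measurable_wrt_lt; exact: Wad.
have mN K : (K <= T)%N -> measurable (N K) by move=> KT; exact/(HM K)/HN.
have mW K : (K <= T)%N -> measurable_fun setT (W K).
  by move=> KT; apply: measurable_wrt_fun (Wad _ KT); exact: HM.
have mLe K : (K <= T)%N -> measurable [set w | c <= W K w].
  by move=> /mW mWK; have := measurable_fun_le measurableT (measurable_cst c) mWK; rewrite setTI.
suff inv K : (K <= T)%N ->
    (c%:E * P (~` N K) + \int[P]_(w in N K) (W K w)%:E <= 1)%E.
  have -> : [set w | exists2 k, (k <= T)%N & c <= W k w] = ~` N T.
    apply/seteqP; split=> w /=.
      by move=> [k kT cW] /(_ _ kT); rewrite ltNge cW.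
    move=> nN; apply: contrapT => nex; apply: nN => i iT; rewrite ltNge.
    by apply/negP => cW; apply: nex; exists i.
  apply: le_trans (inv T (leqnn _)); apply: leeDl.
  by apply: integral_ge0 => w _; rewrite lee_fin.
elim: K => [KT|K IH KT].
  apply: le_trans W01.
  have := @integral_split_level _ _ _ P (W 0%N) c setT (mW _ KT) (W0 _) c0 measurableT.
  rewrite N0 !setTI; congr (_ * P _ + _ <= _)%E.
  by apply/seteqP; split=> w /=; rewrite leNgt => /negP.
apply: le_trans (IH (ltnW KT)).
have := @integral_split_level _ _ _ P (W K.+1) c (N K) (mW _ KT) (W0 _) c0 (mN _ (ltnW KT)).
rewrite -NS => split_le.
rewrite NCS measureU; first last.
- by apply/seteqP; split=> w //= [nN []].
- by apply: measurableI; [apply: mN; exact: ltnW|exact: mLe].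
- by apply: measurableC; apply: mN; exact: ltnW.
rewrite ge0_muleDr// -addeA leeD2l//.
by apply: (le_trans split_le); apply: Wdec => //; apply: HN; exact: ltnW.
Qed.

(** * Exponential supermartingales *)

(** A version Y of the conditional expectation may be negative on a null set or
    be a signed integrable function, so its positive part is compared with Z. *)
Lemma cond_exp_le_integral (d : measure_display) (Omega : measurableType d)
    (R : realType) (P : probability Omega R) (G : set (set Omega))
    (X Z : Omega -> \bar R) (A : set Omega) :
  G `<=` @measurable d Omega -> cond_exp_le P G X Z ->
  measurable_fun setT Z -> (forall w, (0 <= Z w)%E) -> G A ->
  (\int[P]_(w in A) X w <= \int[P]_(w in A) Z w)%E.
Proof.
move=> GM [Y [_ GY _ YX] YZ] mZ Z0 GA.
have mA : measurable A by exact: GM.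
have mY : measurable_fun setT Y by exact: measurable_wrt_fun GY.
rewrite -YX// integralE.
apply: (@le_trans _ _ (\int[P]_(w in A) Y^\+ w)%E).
  rewrite -[leRHS]sube0; apply: leeB => //.
  by apply: integral_ge0 => w _; exact: funeneg_ge0.
apply: ae_ge0_le_integral => //.
- by apply: measurable_funepos; exact: (@measurable_funS _ _ _ _ setT).
- exact: (@measurable_funS _ _ _ _ setT).
- apply: filterS YZ => w YZw _; rewrite funeposE ge_max YZw; exact: Z0.
Qed.

(** The random parameter lemma is used twice: for the slope b in the exponent,
    and then, through the linear functions |x| X of a parameter x, for the weight
    Z exp(- b^2 sigma^2 v), which cancels the right-hand side. *)
Lemma integral_subgaussian_step (d : measure_display) (Omega : measurableType d)
    (R : realType) (P : probability Omega R) (G : set (set Omega))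
    (theta v b Z : Omega -> R) (sigma : R) (A : set Omega) :
  sigma_algebra setT G -> G `<=` @measurable d Omega ->
  measurable_fun setT theta ->
  measurable_wrt G v -> (forall w, 0 <= v w) ->
  (forall lambda : R, cond_exp_le P G
    (fun w => (expR (lambda * theta w))%:E)
    (fun w => (expR (lambda ^+ 2 * sigma ^+ 2 * v w))%:E)) ->
  measurable_wrt G b -> (forall w, 0 <= b w) ->
  measurable_wrt G Z -> (forall w, 0 <= Z w) ->
  G A ->
  (\int[P]_(w in A)
     (Z w * expR (b w * theta w - b w ^+ 2 * sigma ^+ 2 * v w))%:E <=
   \int[P]_(w in A) (Z w)%:E)%E.
Proof.
move=> sG GM mth Gv v0 sub Gb b0 GZ Z0 GA.
have mv := measurable_wrt_fun GM Gv.
have mb := measurable_wrt_fun GM Gb.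
have mexp (X : Omega -> R) : measurable_fun setT X ->
    measurable_fun setT (expR \o X).
  by move=> mX; apply: measurableT_comp => //; exact: measurable_expR.
have mgb : measurable_fun setT
    (fun w => expR (b w ^+ 2 * sigma ^+ 2 * v w)).
  by apply: mexp; do 2 apply: measurable_funM => //; exact: measurable_funX.
have step1 : forall A, G A ->
    (\int[P]_(w in A) (expR (b w * theta w))%:E <=
     \int[P]_(w in A) (expR (b w ^+ 2 * sigma ^+ 2 * v w))%:E)%E.
  apply: (@le_integral_random_parameter _ _ _ P G
    (fun x w => expR (x * theta w))
    (fun x w => expR (x ^+ 2 * sigma ^+ 2 * v w)) b) => //.
  - by move=> x; apply: mexp; exact: measurable_funM.
  - by move=> x; apply: mexp; exact: measurable_funM.
  - move=> x B GB; apply: cond_exp_le_integral (sub x) _ _ GB => //.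
    by apply/measurable_EFinP; apply: mexp; exact: measurable_funM.
  - move=> w x; apply: continuous_comp; last exact: continuous_expR.
    by apply: cvgM; [exact: cvg_id|exact: cvg_cst].
  - move=> x y w x0 xy; rewrite ler_expR ler_wpM2r// ler_wpM2r ?sqr_ge0//.
    by rewrite lerXn2r ?nnegrE// (le_trans x0).
pose L w := Z w * expR (- (b w ^+ 2 * sigma ^+ 2 * v w)).
have GL : measurable_wrt G L.
  apply/(measurable_wrtP _ sG); apply: measurable_funM; first exact/measurable_wrtP.
  apply: (@measurableT_comp _ _ _ _ _ _ expR); first exact: measurable_expR.
  apply: measurableT_comp => //; apply: measurable_funM; last exact/measurable_wrtP.
  by apply: measurable_funM => //; apply: measurable_funX; exact/measurable_wrtP.
have mL := measurable_wrt_fun GM GL.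
have L0 w : 0 <= L w by rewrite mulr_ge0// expR_ge0.
(* The absolute value keeps the integrands nonnegative for every real x. *)
have step2 :
    (\int[P]_(w in A) (`|L w| * expR (b w * theta w))%:E <=
     \int[P]_(w in A) (`|L w| * expR (b w ^+ 2 * sigma ^+ 2 * v w))%:E)%E.
  apply: (@le_integral_random_parameter _ _ _ P G
    (fun x w => `|x| * expR (b w * theta w))
    (fun x w => `|x| * expR (b w ^+ 2 * sigma ^+ 2 * v w)) L) => //.
  - by move=> x; apply: measurable_funM => //; apply: mexp; exact: measurable_funM.
  - by move=> x; exact: measurable_funM.
  - move=> x B GB; under eq_integral do rewrite EFinM.
    under [leRHS]eq_integral do rewrite EFinM.
    have mB : measurable B by exact: GM.
    rewrite !ge0_integralZl_EFin//.
    + by apply: lee_wpmul2l => //; exact: step1.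
    + by apply: (@measurable_funS _ _ _ _ setT) => //; exact/measurable_EFinP.
    + apply: (@measurable_funS _ _ _ _ setT) => //; apply/measurable_EFinP.
      by apply: mexp; exact: measurable_funM.
  - by move=> w x; apply: cvgM; [exact: norm_continuous|exact: cvg_cst].
  - by move=> x y w x0 xy; rewrite ler_wpM2r ?expR_ge0// !ger0_norm// (le_trans x0).
  - by apply: measurable_funM => //; exact: measurableT_comp.
move: step2; congr (_ <= _)%E; apply: eq_integral => w _; congr EFin.
  by rewrite ger0_norm// /L -[LHS]mulrA -expRD addrC.
by rewrite ger0_norm// /L -[LHS]mulrA -expRD addNr expR0 mulr1.
Qed.

(** The predictable weights a k multiply the increments; the process
    exp(lambda M_K - lambda^2 sigma^2 V_K) is a supermartingale by
    [integral_subgaussian_step] with the random slope lambda a_k. *)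
Lemma subgaussian_line_crossing (d : measure_display)
    (Omega : measurableType d) (R : realType) (P : probability Omega R)
    (T : nat) (H : nat -> set (set Omega)) (theta v a : nat -> Omega -> R)
    (sigma lambda x : R) :
  let M K w := \sum_(k < K) theta k w * a k w in
  let V K w := \sum_(k < K) v k w * a k w ^+ 2 in
  filtration T H ->
  (forall k, (k < T)%N -> measurable_wrt (H k.+1) (theta k)) ->
  (forall k, (k < T)%N -> measurable_wrt (H k) (v k)) ->
  (forall k w, (k < T)%N -> 0 <= v k w) ->
  (forall k, (k < T)%N -> measurable_wrt (H k) (a k)) ->
  (forall k w, (k < T)%N -> 0 <= a k w) ->
  (forall k, (k < T)%N -> forall mu : R, cond_exp_le P (H k)
     (fun w => (expR (mu * theta k w))%:E)
     (fun w => (expR (mu ^+ 2 * sigma ^+ 2 * v k w))%:E)) ->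
  0 <= lambda ->
  let E := [set w | exists2 K, (K <= T)%N &
    x <= lambda * M K w - lambda ^+ 2 * sigma ^+ 2 * V K w] in
  measurable E /\ (P E <= (expR (- x))%:E)%E.
Proof.
move=> M V Hf Hth Hv v0 Ha a0 sub l0 E; have [Hs HM Hnd] := Hf.
pose Y K w := lambda * M K w - lambda ^+ 2 * sigma ^+ 2 * V K w.
have HY K : (K <= T)%N -> measurable_wrt (H K) (Y K).
  move=> KT; have sK := Hs K KT.
  have mono (X : Omega -> R) k : (k <= K)%N -> measurable_wrt (H k) X ->
      measurable_fun setT (X : g_sigma_algebraType (H K) -> R).
    by move=> kK HX; apply/measurable_wrtP => //; apply: measurable_wrt_le HX; exact: Hnd.
  have kT (k : 'I_K) : (k < T)%N by exact: leq_trans KT.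
  apply/measurable_wrtP => //; apply: measurable_funB.
    apply: measurable_funM => //; apply: measurable_sum => k.
    apply: measurable_funM; first exact: (mono _ k.+1 (ltn_ord k) (Hth _ (kT k))).
    exact: (mono _ k (ltnW (ltn_ord k)) (Ha _ (kT k))).
  apply: measurable_funM => //; apply: measurable_sum => k.
  apply: measurable_funM; first exact: (mono _ k (ltnW (ltn_ord k)) (Hv _ (kT k))).
  apply: measurable_funX.
  exact: (mono _ k (ltnW (ltn_ord k)) (Ha _ (kT k))).
have mY K : (K <= T)%N -> measurable_fun setT (Y K).
  by move=> KT; apply: measurable_wrt_fun (HY _ KT); exact: HM.
have mE : measurable E.
  rewrite (_ : E = \bigcup_(K in [set K | (K <= T)%N]) [set w | x <= Y K w]).
    apply: bigcup_measurable => K KT.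
    by have := measurable_fun_le measurableT (measurable_cst x) (mY K KT); rewrite setTI.
  by apply/seteqP; split=> w [K KT xY]; exists K.
split=> //.
have := @supermartingale_maximal_inequality _ _ _ P T H
  (fun K w => expR (Y K w)) (expR x) Hf (expR_ge0 x).
rewrite (_ : [set w | _] = E); last first.
  by apply/seteqP; split=> w [K KT xY]; exists K => //; move: xY; rewrite ler_expR.
move=> maximal.
(* Reduces to the maximal inequality at the level exp x. *)
rewrite -[leLHS]mul1e -(expR0 R) -(addNr x) expRD EFinM -muleA -[leRHS]mule1.
apply: lee_wpmul2l; first by rewrite lee_fin expR_ge0.
apply: maximal.
- move=> K KT; apply/measurable_wrtP; first exact: Hs.
  apply: measurableT_comp; first exact: measurable_expR.
  by apply/measurable_wrtP; [exact: Hs|exact: HY].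
- by move=> K w; exact: expR_ge0.
- under eq_integral do rewrite /Y /M /V !big_ord0 !mulr0 subr0 expR0.
  by rewrite integral_cst// mul1e probability_le1.
- move=> k A kT HA; have kT' := ltnW kT.
  have := @integral_subgaussian_step _ _ _ P (H k) (theta k) (v k)
    (fun w => lambda * a k w) (fun w => expR (Y k w)) sigma A
    (Hs _ kT') (HM _ kT').
  have mth := measurable_wrt_fun (HM _ kT) (Hth _ kT).
  have Hb : measurable_wrt (H k) (fun w => lambda * a k w).
    apply/measurable_wrtP; first exact: Hs.
    by apply: measurable_funM => //; apply/measurable_wrtP; [exact: Hs|exact: Ha].
  have HW : measurable_wrt (H k) (fun w => expR (Y k w)).
    apply/measurable_wrtP; first exact: Hs.
    apply: measurableT_comp; first exact: measurable_expR.
    by apply/measurable_wrtP; [exact: Hs|exact: HY].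
  have b0 w : 0 <= lambda * a k w by rewrite mulr_ge0// a0.
  have W0 w : 0 <= expR (Y k w) by exact: expR_ge0.
  move=> /(_ mth (Hv _ kT) (fun w => v0 _ w kT) (sub _ kT) Hb b0 HW W0 HA).
  congr (_ <= _)%E; apply: eq_integral => w _; rewrite -expRD; congr (expR _)%:E.
  rewrite /Y /M /V !big_ord_recr/=; ring.
Qed.

(** * Peeling over the variance budget *)

Lemma sum_peeling_weights (R : realType) (n : nat) :
  \sum_(j < n) ((j.+1%:R * j.+2%:R)^-1 : R) <= 1.
Proof.
suff -> : \sum_(j < n) ((j.+1%:R * j.+2%:R)^-1 : R) = 1 - n.+1%:R^-1.
  by rewrite gerBl invr_ge0 ler0n.
elim: n => [|n IH]; first by rewrite big_ord0 invr1 subrr.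
have n1 : n.+1%:R != 0 :> R by rewrite pnatr_eq0.
have n2 : n.+2%:R != 0 :> R by rewrite pnatr_eq0.
rewrite big_ord_recr/= {}IH -[n.+2%:R]natr1; field.
by move: n1 n2; rewrite -[n.+2%:R]natr1 -[n.+1%:R]nat1r => -> ->.
Qed.

(** Here lev j is the largest budget in the layer j, and p stands for P_K.  The
    layer is that of u = A / p^2.  Since u >= lev j / e, crossing the boundary
    gives lambda_j M >= (2 + 2 C) G, whereas V <= u <= lev j gives
    lambda_j^2 sigma^2 V <= G.  What remains is (1 + 2 C) G, and it dominates
    log 2 + 2 log (j+1) + log (1/delta).  The number of layers in use is bounded
    by exp(C G), so finitely many suffice for all K at once. *)
Lemma boundary_crossing_line_crossing (R : realType) (C sigma delta G U A p M V : R) :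
  let lev j := U * expR (- j%:R) in
  let lambda j := Num.sqrt (G / lev j) / sigma in
  0 < C -> 0 < sigma -> 0 < delta < 1 -> 1 + ln (1 / delta) <= G ->
  0 < A -> 0 < p <= 1 -> A / p ^+ 2 <= U ->
  ln (1 + ln (expR 1 + U / A)) <= C * G ->
  p ^+ 2 * V <= A ->
  Num.sqrt (expR 1) * (2 + 2 * C) * sigma * Num.sqrt (A * G) < p * M ->
  exists2 j, (j < Num.truncn (expR (C * G)))%N &
    ln (j.+1%:R * j.+2%:R / delta) <=
    lambda j * M - lambda j ^+ 2 * sigma ^+ 2 * V.
Proof.
move=> lev lambda C0 s0 /andP[d0 d1] Gge A0 /andP[p0 p1] AU lnU pV SM.
have p20 : 0 < p ^+ 2 by rewrite exprn_gt0.
pose u := A / p ^+ 2.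
have u0 : 0 < u by rewrite divr_gt0.
have U0 : 0 < U by exact: lt_le_trans AU.
have Au : A <= u by rewrite ler_pdivlMr// ger_pMr// exprn_ile1// ltW.
have lnd : 0 <= ln (1 / delta).
  by rewrite ln_ge0// div1r invf_ge1// ltW.
have G1 : 1 <= G by apply: le_trans Gge; rewrite lerDl.
have G0 : 0 < G by exact: lt_le_trans G1.
pose r := ln (U / u).
have r0 : 0 <= r by rewrite ln_ge0// ler_pdivlMr// mul1r.
pose j := Num.truncn r.
have /andP[jr rj] : j%:R <= r < j.+1%:R by exact: truncn_itv.
have lnj : ln (j.+1%:R) <= C * G.
  apply: le_trans lnU; rewrite ler_ln ?posrE//; last first.
    rewrite ltr_pwDl// ln_ge0//.
    by apply: (@le_trans _ _ (expR 1)); [by rewrite ltW// expR_gt1|rewrite lerDl divr_ge0// ltW].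
  rewrite -natr1 addrC lerD2l (le_trans jr)// /r ler_ln ?posrE//.
  - apply: (@le_trans _ _ (U / A)); last by rewrite lerDr expR_ge0.
    by rewrite ler_pM2l// lef_pV2.
  - by rewrite divr_gt0.
  - by rewrite addr_gt0 ?expR_gt0// divr_gt0.
exists j.
  by rewrite truncn_gt_nat -[leLHS]lnK ?posrE// ler_expR.
have lev0 : 0 < lev j by rewrite mulr_gt0// expR_gt0.
have ulev : u <= lev j.
  rewrite /lev expRN ler_pdivlMr ?expR_gt0// mulrC -ler_pdivlMr//.
  by rewrite -[leRHS]lnK ?posrE ?divr_gt0// ler_expR.
have levu : lev j <= expR 1 * u.
  rewrite /lev expRN ler_pdivrMr ?expR_gt0// mulrAC -expRD.
  rewrite -ler_pdivrMr// -[leLHS]lnK ?posrE ?divr_gt0// ler_expR addrC natr1.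
  exact: ltW.
have Vlev : V <= lev j.
  apply: le_trans ulev; by rewrite ler_pdivlMr// mulrC.
have l2 : lambda j ^+ 2 * sigma ^+ 2 = G / lev j.
  by rewrite -exprMn divfK ?gt_eqF// sqr_sqrtr// divr_ge0// ltW.
have lV : lambda j ^+ 2 * sigma ^+ 2 * V <= G.
  by rewrite l2 mulrAC ler_pdivrMr// ler_pM2l.
(* The factor sqrt e in the constant makes up for the width of the layer. *)
have lM : (2 + 2 * C) * G <= lambda j * M.
  have AGE : Num.sqrt (A * G) = p * Num.sqrt (u * G).
    rewrite -[p in RHS]gtr0_norm// -sqrtr_sqr -sqrtrM ?exprn_ge0 ?ltW//.
    by congr Num.sqrt; rewrite mulrA [p ^+ 2 * u]mulrC divfK// gt_eqF.
  have Mge : Num.sqrt (expR 1) * (2 + 2 * C) * sigma * Num.sqrt (u * G) <= M.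
    by rewrite -(ler_pM2l p0) mulrCA -AGE ltW.
  have lam0 : 0 <= lambda j by rewrite divr_ge0 ?sqrtr_ge0 ?ltW.
  apply: le_trans (ler_wpM2l lam0 Mge).
  have -> : lambda j *
      (Num.sqrt (expR 1) * (2 + 2 * C) * sigma * Num.sqrt (u * G)) =
      (2 + 2 * C) *
      (Num.sqrt (G / lev j) * Num.sqrt (expR 1) * Num.sqrt (u * G)).
    by rewrite /lambda; field; rewrite gt_eqF.
  rewrite ler_pM2l; last by lra.
  have Glev0 : 0 <= G / lev j by rewrite divr_ge0 ?ltW.
  rewrite -(sqrtrM _ Glev0) -sqrtrM; last by rewrite mulr_ge0// expR_ge0.
  rewrite [leLHS](_ : _ = Num.sqrt (G ^+ 2)); last by rewrite sqrtr_sqr gtr0_norm.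
  have -> : G / lev j * expR 1 * (u * G) = G ^+ 2 * (expR 1 * u / lev j).
    by field; rewrite gt_eqF.
  have t1 : 1 <= expR 1 * u / lev j by rewrite ler_pdivlMr// mul1r.
  rewrite ler_sqrt; last by rewrite mulr_ge0 ?sqr_ge0// (le_trans ler01).
  by rewrite ler_peMr ?sqr_ge0.
rewrite lnM ?posrE ?mulr_gt0 ?invr_gt0// lnM ?posrE// -[delta^-1]div1r.
have lnj2 : ln (j.+2%:R) <= 1 + ln (j.+1%:R : R).
  have ln2 : ln (2 : R) <= 1 by apply: (@le_ln1Dx R 1); lra.
  apply: (@le_trans _ _ (ln (2 * j.+1%:R))); last by rewrite lnM ?posrE// lerD2r.
  by rewrite ler_ln ?posrE ?mulr_gt0// -natrM ler_nat mul2n -addnn addSn ltnS addnS ltnS leq_addl.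
lra.
Qed.

(** * The crossing probability *)

Lemma le_max_upto (R : realType) (T K : nat) (f : nat -> R) :
  (1 <= K <= T)%N -> f K <= max_upto T f.
Proof.
by move=> KT; rewrite /max_upto; apply: le_bigmax_seq => //; rewrite mem_index_iota ltnS.
Qed.

Lemma Pprod_gt0_le1 (R : realType) (Omega : Type) (q : nat -> Omega -> R)
    (T K : nat) (w : Omega) :
  (forall k w, (k < T)%N -> 0 < q k w <= 1) -> (K <= T)%N ->
  0 < Pprod q K w <= 1.
Proof.
move=> q01; rewrite /Pprod; elim: K => [|K IH] KT; first by rewrite big_ord0 ltr01 lexx.
have /andP[p0 p1] := IH (ltnW KT); have /andP[q0 q1] := q01 K w KT.
by rewrite big_ord_recr/= mulr_gt0//= mulr_ile1// ltW.
Qed.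

Unset Implicit Arguments.

Theorem lemma18 (R : realType) (C : R) (C_gt0 : 0 < C) :
  exists Cst : R,
  forall (d : measure_display) (Omega : measurableType d)
    (P : probability Omega R)
    (T : nat) (T_ge1 : (1 <= T)%N)
    (sigma : R) (sigma_gt0 : 0 < sigma)
    (H : nat -> set (set Omega)) (H_filtration : filtration T H)
    (q v theta : nat -> Omega -> R)
    (q_meas : forall k, (k < T)%N -> measurable_wrt (H k) (q k))
    (q_range : forall k w, (k < T)%N -> 0 < q k w <= 1)
    (v_meas : forall k, (k < T)%N -> measurable_wrt (H k) (v k))
    (v_ge0 : forall k w, (k < T)%N -> 0 <= v k w)
    (theta_meas : forall k, (k < T)%N -> measurable_wrt (H k.+1) (theta k))
    (theta_mean : forall k, (k < T)%N ->
      is_cond_exp P (H k) (fun w => (theta k w)%:E) (fun=> 0%E))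
    (theta_subgaussian : forall k, (k < T)%N -> forall lambda : R,
      cond_exp_le P (H k)
        (fun w => (expR (lambda * theta k w))%:E)
        (fun w => (expR (lambda ^+ 2 * sigma ^+ 2 * v k w))%:E))
    (BT : R) (BT_ge1 : 1 <= BT)
    (PT : set Omega) (PT_event : measurable PT)
    (PT_bound : forall w, PT w -> forall K, (1 <= K <= T)%N ->
      Pprod q K w ^- 2 <= BT)
    (Abar : nat -> R) (Abar_gt0 : forall K, (1 <= K <= T)%N -> 0 < Abar K)
    (delta G : R) (delta_range : 0 < delta < 1)
    (G_ge : 1 + ln (1 / delta) <= G),
  let Ustar : R := BT * max_upto T Abar in
  max_upto T (fun K => ln (1 + ln (expR 1 + Ustar / Abar K))) <= C * G ->
  let crossing : set Omega := [set w | exists K, [/\ (1 <= K <= T)%N,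
      Aproc q v K w <= Abar K &
      Cst * sigma * Num.sqrt (Abar K * G) < Sproc q theta K w]] in
  (P (PT `&` crossing) <= delta%:E)%E.
Proof.
exists (Num.sqrt (expR 1) * (2 + 2 * C)).
move=> d Omega P T T1 sigma s0 H Hf q v theta Hq q01 Hv v0 Hth _ sub BT BT1 PT
  mPT PTB Abar A0 delta G d01 Gge Ustar lnU /=.
set crossing := mkset _.
have [Hs HM Hnd] := Hf; have /andP[d0 d1] := d01.
set Cst := Num.sqrt (expR 1) * _ in crossing *.
have P01 K w : (K <= T)%N -> 0 < Pprod q K w <= 1 by exact: Pprod_gt0_le1.
pose a k w := (Pprod q k.+1 w)^-1.
have a0 k w : (k < T)%N -> 0 <= a k w.
  by move=> kT; rewrite invr_ge0; have /andP[/ltW] := P01 k.+1 w kT.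
have HPprod j K : (K <= T)%N -> (j <= T)%N -> (K <= j.+1)%N ->
    measurable_fun setT (Pprod q K : g_sigma_algebraType (H j) -> R).
  move=> KT jT Kj; apply: measurable_prod => i _.
  apply/(measurable_wrtP _ (Hs _ jT)).
  apply: (measurable_wrt_le _ (Hq _ (leq_trans (ltn_ord i) KT))).
  by apply: Hnd => //; rewrite -ltnS (leq_trans (ltn_ord i)).
have HaE k : (k < T)%N -> measurable_wrt (H k) (a k).
  move=> kT; have kT' := ltnW kT; apply/(measurable_wrtP _ (Hs _ kT')).
  (* 1 / P_(k+1) is a real power of P_(k+1), and powers are measurable. *)
  rewrite (_ : a k = (fun x => x `^ (-1)) \o Pprod q k.+1); last first.
    apply/funext => w /=; rewrite powR_inv1//.
    by have /andP[/ltW] := P01 k.+1 w kT.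
  by apply: measurableT_comp; [exact: measurable_powR|exact: HPprod].
have mPprod K : (K <= T)%N -> measurable_fun setT (Pprod q K).
  move=> KT; apply: (@measurable_wrt_fun _ _ _ _ (H K)); first exact: HM.
  by apply/(measurable_wrtP _ (Hs _ KT)); exact: HPprod.
have ma k : (k < T)%N -> measurable_fun setT (a k).
  by move=> kT; apply: measurable_wrt_fun (HaE _ kT); exact/HM/ltnW.
have mth k : (k < T)%N -> measurable_fun setT (theta k).
  by move=> kT; apply: measurable_wrt_fun (Hth _ kT); exact: HM.
have mv k : (k < T)%N -> measurable_fun setT (v k).
  by move=> kT; apply: measurable_wrt_fun (Hv _ kT); exact/HM/ltnW.
pose M K w := \sum_(k < K) theta k w * a k w.
pose V K w := \sum_(k < K) v k w * a k w ^+ 2.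
have AE K w : Aproc q v K w = Pprod q K w ^+ 2 * V K w.
  by rewrite /Aproc /V; under [in RHS]eq_bigr do rewrite exprVn.
have mS K : (K <= T)%N -> measurable_fun setT (Sproc q theta K).
  move=> KT; apply: measurable_funM; first exact: mPprod.
  apply: measurable_sum => k; have kT := leq_trans (ltn_ord k) KT.
  by apply: measurable_funM; [exact: mth|exact: ma].
have mA K : (K <= T)%N -> measurable_fun setT (Aproc q v K).
  move=> KT; rewrite (_ : Aproc q v K = fun w => Pprod q K w ^+ 2 * V K w); last first.
    by apply/funext => w; exact: AE.
  apply: measurable_funM; first by apply: measurable_funX; exact: mPprod.
  apply: measurable_sum => k; have kT := leq_trans (ltn_ord k) KT.
  by apply: measurable_funM; [exact: mv|apply: measurable_funX; exact: ma].
(* The event has to be measurable for P to be monotone. *)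
have mcross : measurable crossing.
  rewrite (_ : crossing = \bigcup_(K in [set K | (1 <= K <= T)%N])
     ([set w | Aproc q v K w <= Abar K] `&`
      ~` [set w | Sproc q theta K w <= Cst * sigma * Num.sqrt (Abar K * G)])).
    apply: bigcup_measurable => K /= /andP[_ KT]; apply: measurableI.
      have := measurable_fun_le measurableT (mA K KT) (measurable_cst (Abar K)).
      by rewrite setTI.
    apply: measurableC.
    have := measurable_fun_le measurableT (mS K KT)
      (measurable_cst (Cst * sigma * Num.sqrt (Abar K * G))).
    by rewrite setTI.
  apply/seteqP; split=> w.
    by move=> [K [KT AK SK]]; exists K => //; split=> //=; apply/negP; rewrite -ltNge.
  by move=> [K KT [/= AK /negP]]; rewrite -ltNge; exists K.
pose lambda j := Num.sqrt (G / (Ustar * expR (- j%:R))) / sigma.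
pose x j := ln (j.+1%:R * j.+2%:R / delta).
pose E j := [set w | exists2 K, (K <= T)%N &
    x j <= lambda j * M K w - lambda j ^+ 2 * sigma ^+ 2 * V K w].
have EP j : measurable (E j) /\ (P (E j) <= (expR (- x j))%:E)%E.
  apply: (@subgaussian_line_crossing _ _ _ P T H theta v a) => //.
  by rewrite divr_ge0 ?sqrtr_ge0 ?ltW.
pose J := Num.truncn (expR (C * G)).
have cover : PT `&` crossing `<=` \big[setU/set0]_(j < J) E j.
  move=> w [PTw [K [K1T AK SK]]]; have /andP[K1 KT] := K1T.
  have [||||||||||j jJ xj] := @boundary_crossing_line_crossing R C sigma delta G Ustar (Abar K)
    (Pprod q K w) (M K w) (V K w) => //.
  - exact: A0.
  - exact: P01.
  - rewrite mulrC; apply: ler_pM => //.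
    + by rewrite invr_ge0 sqr_ge0.
    + exact/ltW/A0.
    + exact: PTB.
    + exact: le_max_upto.
  - apply: le_trans lnU.
    exact: (@le_max_upto _ T K (fun K => ln (1 + ln (expR 1 + Ustar / Abar K)))).
  - by rewrite -AE.
  - by rewrite -bigcup_mkord; exists j => //; exists K.
apply: (@le_trans _ _ (P (\big[setU/set0]_(j < J) E j))).
  apply: le_measure => //; rewrite inE; first exact: measurableI.
  by apply: bigsetU_measurable => j _; have [] := EP j.
apply: (le_trans (Boole_inequality _ _)); first by move=> j _; have [] := EP j.
apply: (@le_trans _ _ (\sum_(j < J) (delta * (j.+1%:R * j.+2%:R)^-1)%:E)%E).
  apply: lee_sum => j _; apply: (le_trans (EP j).2).
  rewrite lee_fin /x expRN lnK; first by rewrite invf_div.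
  by rewrite posrE divr_gt0// mulr_gt0.
rewrite sumEFin lee_fin -mulr_sumr -[leRHS]mulr1 ler_pM2l//.
exact: sum_peeling_weights.
Qed.
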